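(* Let $\mathsf{A}\subset\mathbb{R}^D$ be a compact set, let $0<\epsilon\le M<\infty$, and let $\mathcal{A}$ be a set of probability densities such that every $q\in\mathcal{A}$ (A1) is a truncated density with bounded support $\mathsf{A}$ (so $q(\mathbf{z})=0$ for $\mathbf{z}\notin\mathsf{A}$), and (A2) satisfies $\epsilon\le q(\mathbf{z})\le M$ for all $\mathbf{z}\in\mathsf{A}$. Let $p_{\mathbf{x}}$ be a probability density that is strictly positive on a set $\mathsf{Z}\supseteq\mathsf{A}$, let $f(q)=D^{KL}(q\|p_{\mathbf{x}})$, let $L=\frac{1}{\epsilon}$, and let $C_{f,\mathcal{A}}$ be the curvature of $f$ over $\mathrm{conv}(\mathcal{A})$. Then $$C_{f,\mathcal{A}}\le L\,\mathrm{diam}(\mathcal{A})^2\le 4\,\frac{M^2}{\epsilon}\,\mathcal{L}(\mathsf{A}),$$ where $\mathcal{L}(\mathsf{A})$ is the Lebesgue measure of $\mathsf{A}$.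
   Context: Densities are regarded as elements of $L^2$ with inner product $\langle p,q\rangle=\int p(\mathbf{z})q(\mathbf{z})\,d\mathbf{z}$ and induced norm $\|\cdot\|$; $\mathrm{conv}(\mathcal{A})$ is the convex hull and $\mathrm{diam}(\mathcal{A})=\sup_{q_1,q_2\in\mathcal{A}}\|q_1-q_2\|$ (written as a max in the paper). $D^{KL}(q\|p_{\mathbf{x}})=\int_{\mathsf{A}} q\log\frac{q}{p_{\mathbf{x}}}\,d\mathbf{z}$, with functional gradient $\nabla f(q)=\log\frac{q}{p_{\mathbf{x}}}$. The curvature is $$C_{f,\mathcal{A}}:=\sup_{\substack{s\in\mathcal{A},\ q\in\mathrm{conv}(\mathcal{A}),\ \gamma\in(0,1]\\ y=q+\gamma(s-q)}}\frac{2}{\gamma^2}\big(f(y)-f(q)-\langle y-q,\nabla f(q)\rangle\big).$$ *)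

(* Defs.v *)
From HB Require Import structures.
From mathcomp Require Import all_boot all_order all_algebra.
From mathcomp Require Import all_classical all_reals all_analysis.

Set Implicit Arguments.
Unset Strict Implicit.
Unset Printing Implicit Defensive.

Import Order.TTheory GRing.Theory Num.Theory.
Import numFieldNormedType.Exports.

Local Open Scope classical_set_scope.
Local Open Scope ring_scope.

(* R^n as row vectors: the topology is the library's (product) topology on
   matrices, and the sigma-algebra is the one generated by the n coordinates,
   i.e. the Borel sigma-algebra, built as the library does for n.-tuple. *)
Definition Rn (R : realType) (n : nat) : Type := 'rV[R]_n.

HB.instance Definition _ (R : realType) (n : nat) := NormedModule.on (Rn R n).

Section Rn_measurable.
Variables (R : realType) (n : nat).

Let coord (i : 'I_n) (v : Rn R n) : measurableTypeR R := v ord0 i.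

Let Rn_set0 : g_sigma_preimage coord set0.
Proof. exact: sigma_algebra0. Qed.

Let Rn_setC A : g_sigma_preimage coord A -> g_sigma_preimage coord (~` A).
Proof. exact: sigma_algebraC. Qed.

Let Rn_bigcup (F : _^nat) : (forall i, g_sigma_preimage coord (F i)) ->
  g_sigma_preimage coord (\bigcup_i (F i)).
Proof. exact: sigma_algebra_bigcup. Qed.

HB.instance Definition _ := @isMeasurable.Build default_measure_display
  (Rn R n) (g_sigma_preimage coord) Rn_set0 Rn_setC Rn_bigcup.

Lemma measurable_coord (i : 'I_n) :
  measurable_fun [set: Rn R n] (fun v : Rn R n => v ord0 i : measurableTypeR R).
Proof.
move=> _ Y mY; rewrite setTI; apply: sub_sigma_algebra => /=.
rewrite -bigcup_seq/=; exists i => /=; first by rewrite mem_index_enum.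
by exists Y => //; rewrite setTI.
Qed.

Lemma measurable_fun_coordP d (T : measurableType d) (f : T -> Rn R n) :
  (forall i, measurable_fun setT (fun x => f x ord0 i : measurableTypeR R)) ->
  measurable_fun setT f.
Proof.
move=> mf; have mf' : preimage_set_system setT f measurable `<=` measurable.
  move=> A [B] + <-; rewrite setTI.
  pose S := [set B : set (Rn R n) | measurable (f @^-1` B)].
  suff : measurable `<=` S by move=> /(_ B).
  apply: smallest_sub => [|C].
    split => /=.
    - by rewrite /S/= preimage_set0.
    - by move=> X; rewrite /S/= => mX; rewrite setTD preimage_setC; exact: measurableC.
    - by move=> F mF; rewrite /S/= preimage_bigcup; exact: bigcupT_measurable.
  rewrite -bigcup_seq/= => -[i _ [D mD <-]].
  by rewrite /S/= setTI; have := mf i measurableT _ mD; rewrite setTI.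
by move=> _ B mB; rewrite setTI; apply: mf'; exists B => //; rewrite setTI.
Qed.

End Rn_measurable.

Definition Rn_cons (R : realType) (n : nat)
    (xv : measurableTypeR R * Rn R n) : Rn R n.+1 :=
  row_mx (xv.1 : R)%:M (xv.2 : 'rV[R]_n) : 'rV[R]_(1 + n).

Lemma Rn_cons0 (R : realType) (n : nat) (x : measurableTypeR R) (v : Rn R n) :
  Rn_cons (x, v) ord0 ord0 = x.
Proof.
have -> : (ord0 : 'I_n.+1) = lshift n (ord0 : 'I_1) by exact: val_inj.
by apply: etrans (row_mxEl _ _ _ _) _; rewrite mxE.
Qed.

Lemma Rn_consS (R : realType) (n : nat) (x : measurableTypeR R) (v : Rn R n)
    (j : 'I_n) : Rn_cons (x, v) ord0 (lift ord0 j) = v ord0 j.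
Proof.
have -> : lift ord0 j = rshift 1 j by exact: val_inj.
exact: row_mxEr.
Qed.

Lemma measurable_Rn_cons (R : realType) (n : nat) :
  measurable_fun setT (@Rn_cons R n).
Proof.
apply: measurable_fun_coordP => i; have [j ->|->] := unliftP ord0 i.
  rewrite [X in measurable_fun _ X](_ : _ =
    (fun v : Rn R n => v ord0 j : measurableTypeR R) \o snd); last first.
    by apply/funext => -[x v]; exact: Rn_consS.
  exact: (measurableT_comp (@measurable_coord R n j) measurable_snd).
rewrite [X in measurable_fun _ X](_ : _ = fst); first exact: measurable_fst.
by apply/funext => -[x v]; exact: Rn_cons0.
Qed.

Section Rn_cons_measure.
Context (R : realType) (n : nat).
Variable m : {measure set (measurableTypeR R * Rn R n) -> \bar R}.

Definition push_cons : set (Rn R n.+1) -> \bar R :=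
  pushforward m (@Rn_cons R n).

Let push0 : push_cons set0 = 0%E.
Proof. by rewrite /push_cons /pushforward preimage_set0 measure0. Qed.

Let push_ge0 A : (0 <= push_cons A)%E.
Proof. exact: (measure_ge0 m). Qed.

Let push_sigma_additive : semi_sigma_additive push_cons.
Proof.
have mP X : measurable X -> measurable (@Rn_cons R n @^-1` X).
  by move=> mX; rewrite -[Y in measurable Y]setTI; exact: measurable_Rn_cons.
move=> F mF tF mUF; rewrite /push_cons /pushforward preimage_bigcup.
apply: measure_semi_sigma_additive.
- by move=> k; exact: mP.
- apply/trivIsetP => /= i j _ _ ij; rewrite -preimage_setI.
  by move/trivIsetP : tF => /(_ _ _ _ _ ij) ->//; rewrite preimage_set0.
- by rewrite -preimage_bigcup; exact: mP.
Qed.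

HB.instance Definition _ := isMeasure.Build _ _ _ push_cons
  push0 push_ge0 push_sigma_additive.

End Rn_cons_measure.

(* n-dimensional Lebesgue measure: the n-fold product of the one-dimensional
   one, transported along R * R^n ~ R^n.+1 (R^0 is a point of mass 1). *)
Fixpoint lebesgue_Rn (R : realType) (n : nat) :
    {measure set (Rn R n) -> \bar R} :=
  match n with
  | 0 => \d_ (0 : Rn R 0)
  | n.+1 => push_cons (lebesgue_measure \x^ lebesgue_Rn R n)%E
  end.

Lemma lebesgue_Rn_box (R : realType) (n : nat)
    (B : 'I_n -> set (measurableTypeR R)) : (forall i, measurable (B i)) ->
  lebesgue_Rn R n [set v | forall i, B i (v ord0 i)] =
  (\prod_(i < n) lebesgue_measure (B i))%E.
Proof.
elim: n B => [|n IH] B mB.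
  by rewrite big_ord0 /= diracE mem_set// => -[].
rewrite big_ord_recl -IH//= /push_cons /pushforward.
rewrite -(@product_measure2E _ _ _ _ _ _ (lebesgue_Rn R n))//; last first.
  rewrite [X in measurable X](_ : _ = \bigcap_(i in [set: 'I_n])
      ((fun v : Rn R n => v ord0 i : measurableTypeR R) @^-1` B (lift ord0 i))).
    apply: fin_bigcap_measurable => // i _.
    by rewrite -[X in measurable X]setTI; exact: measurable_coord.
  by apply/seteqP; split=> v /= Bv i; [move=> _|]; exact: Bv.
congr (_ _); apply/seteqP; split=> -[x v] /=.
  move=> H; split=> [|i]; first by have := H ord0; rewrite Rn_cons0.
  by have := H (lift ord0 i); rewrite Rn_consS.
move=> [Bx Bv] i; have [j ->|->] := unliftP ord0 i.
  by rewrite Rn_consS.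
by rewrite Rn_cons0.
Qed.

Section densities.
Context d (T : measurableType d) (R : realType).
Variable mu : {measure set T -> \bar R}.

Definition is_density (p : T -> R) : Prop :=
  [/\ measurable_fun setT p, forall z, 0 <= p z & (\int[mu]_z (p z)%:E = 1)%E].

Definition L2_inner (p q : T -> R) : \bar R := (\int[mu]_z (p z * q z)%:E)%E.

Definition L2_dist (p q : T -> R) : \bar R :=
  ('N[mu]_2 [ (fun z => (p z - q z)%:E) ])%E.

(* The supremum is taken in [0, +oo], so that the empty family has diameter 0;
   the added 0 is irrelevant for nonempty families. *)
Definition L2_diam (Q : set (T -> R)) : \bar R :=
  ereal_sup (0%E |` [set L2_dist q1 q2 | q1 in Q & q2 in Q]).

Definition KL_div (A : set T) (q p : T -> R) : \bar R :=
  (\int[mu]_(z in A) (q z * ln (q z / p z))%:E)%E.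

Definition KL_grad (q p : T -> R) : T -> R := fun z => ln (q z / p z).

(* R^o is R as a module over itself, which makes T -> R^o an R-module. *)
Definition conv_hull (Q : set (T -> R)) : set (T -> R) :=
  smallest (@convex_set R (T -> R^o)) Q.

(* [gradf q] represents the gradient of [f] at [q] through the L^2 pairing.
   Values are extended reals: should [f] be infinite at some point, the library
   convention +oo - +oo = -oo makes the corresponding terms -oo. *)
Definition curvature (f : (T -> R) -> \bar R) (gradf : (T -> R) -> (T -> R))
    (Q : set (T -> R)) : \bar R :=
  ereal_sup [set c | exists s q y : T -> R, exists gamma : R,
    [/\ Q s, conv_hull Q q, 0 < gamma <= 1,
        y = (fun z => q z + gamma * (s z - q z)) &
        c = ((2 / gamma ^+ 2)%:E *
             (f y - f q - L2_inner (fun z => y z - q z)%R (gradf q)))%E]].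

End densities.

(* Main.v *)
(* The Bregman divergence of the Kullback-Leibler functional is again a
   Kullback-Leibler divergence: f(y) - f(q) - <y - q, grad f(q)> is the integral
   over A of y ln(y/q), the terms involving p cancelling out. Pointwise
   y ln(y/q) <= (y - q) + (y - q)^2 / (2 eps), and y - q has integral 0, which
   leaves gamma^2 / (2 eps) |s - q|^2. The distance from s to the convex hull of Q
   is at most diam(Q) since balls are convex. The cancellation requires f(q) to be
   finite; if f(q) = +oo, the term of the curvature is -oo by convention. The set A is
   measurable and of measure at most 1/eps because any q in Q satisfies
   A = {q >= eps}. *)

Require Import Defs.
From mathcomp Require Import all_boot all_order all_algebra.
From mathcomp Require Import all_classical all_reals all_analysis.
From mathcomp Require Import measurable_realfun.
From mathcomp Require Import ring lra.

Set Implicit Arguments.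
Unset Strict Implicit.

Import Order.TTheory GRing.Theory Num.Theory.
Import numFieldNormedType.Exports.

Local Open Scope classical_set_scope.
Local Open Scope ring_scope.

(** * Scalar inequalities for the logarithm *)

Lemma ln_le_subr1 (R : realType) (x : R) : 0 < x -> ln x <= x - 1.
Proof.
by move=> x0; have := @le_ln1Dx R (x - 1); rewrite [1 + _]addrC subrK; apply; lra.
Qed.

(** This is [ln x <= x - 1] at [x = q / y], multiplied by [- y]. *)
Lemma sub_le_mul_ln (R : realType) (y q : R) : 0 < y -> 0 < q ->
  y - q <= y * ln (y / q).
Proof.
move=> y0 q0; have -> : ln (y / q) = - ln (q / y).
  by rewrite -invf_div lnV// posrE divr_gt0.
have h : ln (q / y) <= q / y - 1 by rewrite ln_le_subr1// divr_gt0.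
rewrite mulrN lerNr opprB; apply: le_trans (ler_wpM2l (ltW y0) h) _.
by rewrite mulrBr mulr1 mulrCA divff ?mulr1// gt_eqF.
Qed.

(* The remainder of the Taylor expansion of t |-> t ln t at q: its second
   derivative 1/t is at most 1/e on [e, +oo[. *)
Lemma mul_ln_le_quad (R : realType) (e y q : R) : 0 < e -> e <= y -> e <= q ->
  y * ln (y / q) <= (y - q) + (y - q) ^+ 2 / (2 * e).
Proof.
move=> e0 ey eq_; have y0 : 0 < y by lra. have q0 : 0 < q by lra.
(* [h] is the right side minus the left side as a function of [y], and [dh] is its derivative;
   [h q = 0]. *)
pose h (t : R) : R := (t - q) ^+ 2 / (2 * e) + (t - q) - t * (ln t - ln q).
pose dh (t : R) : R := (t - q) / e - (ln t - ln q).
have hD (t : R) : 0 < t -> is_derive t 1 h (dh t).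
  move=> t0; rewrite /h; have ? := is_derive1_ln t0.
  apply: is_derive_eq; rewrite /dh /GRing.scale/=.
  by field; rewrite !gt_eqF.
have hc (a b : R) : 0 < a -> {within `[a, b], continuous h}.
  move=> a0; apply: derivable_within_continuous => t; rewrite in_itv/= => /andP[at_ _].
  by have [] := hD t (lt_le_trans a0 at_).
(* [dh] has the sign of [t - q] on [[e, +oo[], so that [h] is minimal at [q] there. On each side
   this is [ln x <= x - 1], at [t / q] or [q / t], with the denominator lowered to [e]. *)
have dhq (t : R) : e <= t -> 0 <= dh t * (t - q).
  move=> et; have t0 : 0 < t by lra.
  have [qt|tq] := leP q t.
    rewrite mulr_ge0 ?subr_ge0// /dh -ln_div ?posrE//.
    apply: le_trans (ln_le_subr1 _) _; first exact: divr_gt0.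
    rewrite -[X in _ - X <= _](@divff _ q) ?gt_eqF// -mulrBl.
    by rewrite ler_wpM2l ?subr_ge0// lef_pV2 ?posrE.
  have : ln (q / t) <= q / t - 1 by rewrite ln_le_subr1// divr_gt0.
  rewrite ln_div ?posrE// -[X in _ <= _ - X](@divff _ t) ?gt_eqF// -mulrBl => lqt.
  have : (q - t) / t <= (q - t) / e by rewrite ler_wpM2l ?lef_pV2 ?posrE//; lra.
  have -> : (q - t) / e = - ((t - q) / e) by rewrite -mulNr opprB.
  by move=> qte; rewrite mulr_le0// /dh; lra.
suff : 0 <= h y by rewrite /h ln_div ?posrE//; lra.
have hq : h q = 0 by rewrite /h !subrr expr0n/= mulr0 mul0r addr0 subrr.
have [qy|yq] := leP q y.
  have hDqy t : t \in `]q, y[ -> is_derive t 1 h (dh t).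
    by rewrite in_itv/= => /andP[qt _]; apply/hD/(lt_trans q0).
  have [c] := MVT_segment qy hDqy (hc q y q0).
  rewrite in_itv/= hq subr0 => /andP[qc cy] ->.
  (* The mean value point is only known to lie in the closed interval; at [c = q] the derivative is
     0. *)
  have [->|cq] := eqVneq c q.
    by rewrite /dh !subrr mul0r subrr mul0r.
  rewrite mulr_ge0//; last lra.
  have := dhq c (le_trans eq_ qc); rewrite pmulr_lge0// subr_gt0.
  by rewrite lt_neqAle eq_sym cq.
have hDyq t : t \in `]y, q[ -> is_derive t 1 h (dh t).
  by rewrite in_itv/= => /andP[yt _]; apply/hD/(lt_trans y0).
have [c] := MVT_segment (ltW yq) hDyq (hc y q y0).
rewrite in_itv/= hq sub0r => /andP[yc cq] hyE.
rewrite -oppr_le0 hyE; have [->|cq'] := eqVneq c q.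
  by rewrite /dh !subrr mul0r subrr mul0r.
rewrite mulr_le0_ge0//; last lra.
have := dhq c (le_trans ey yc); rewrite nmulr_lge0// subr_lt0.
by rewrite lt_neqAle cq'.
Qed.

(** * Squared distances and the diameter *)

Lemma L2_distE d (T : measurableType d) (R : realType)
    (mu : {measure set T -> \bar R}) (p q : T -> R) :
  (L2_dist mu p q ^+ 2 = \int[mu]_z ((p z - q z) ^+ 2)%:E)%E.
Proof.
have -> : (L2_dist mu p q ^+ 2 = L2_dist mu p q `^ 2)%E.
  rewrite expe2 -[X in (_ `^ X)%E]/(1 + 1) poweRD; last by rewrite add_neq0_poweRD_def.
  by rewrite !poweRe1// Lnorm_ge0.
rewrite poweR_Lnorm//; apply: eq_integral => z _.
by rewrite abse_EFin poweR_EFin powR_mulrn// real_normK// num_real.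
Qed.

Lemma L2_diam_ge0 d (T : measurableType d) (R : realType)
    (mu : {measure set T -> \bar R}) (Q : set (T -> R)) : (0 <= L2_diam mu Q)%E.
Proof. by apply: ereal_sup_ubound; left. Qed.

Lemma L2_dist_le_diam d (T : measurableType d) (R : realType)
    (mu : {measure set T -> \bar R}) (Q : set (T -> R)) (p q : T -> R) :
  Q p -> Q q -> (L2_dist mu p q <= L2_diam mu Q)%E.
Proof. by move=> Qp Qq; apply: ereal_sup_ubound; right; exists p => //; exists q. Qed.

(** The diameter is a supremum of distances while the estimates concern their squares: each distance
    is compared with [sqrte a], which also covers [a = +oo]. *)
Lemma L2_diam_le d (T : measurableType d) (R : realType)
    (mu : {measure set T -> \bar R}) (Q : set (T -> R)) (a : \bar R) :
  (0 <= a)%E -> (forall p q, Q p -> Q q -> L2_dist mu p q ^+ 2 <= a)%E ->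
  (L2_diam mu Q ^+ 2 <= a)%E.
Proof.
move=> a0 Qa; have sqa : (sqrte a ^+ 2 = a)%E by rewrite sqr_sqrte.
rewrite -[leRHS]sqa lee_sqr ?L2_diam_ge0 ?sqrte_ge0//.
apply: ge_ereal_sup => _ [->|[p Qp [q Qq <-]]]; first exact: sqrte_ge0.
by rewrite -lee_sqr ?Lnorm_ge0 ?sqrte_ge0// sqa Qa.
Qed.

(** * Truncated densities and their convex hull *)

Lemma integral_support d (T : measurableType d) (R : realType)
    (mu : {measure set T -> \bar R}) (A : set T) (h : T -> R) :
  (forall z, ~ A z -> h z = 0) ->
  (\int[mu]_z (h z)%:E = \int[mu]_(z in A) (h z)%:E)%E.
Proof.
move=> h0; rewrite [RHS]integral_mkcond; apply: eq_integral => z _.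
by rewrite patchE; case: ifPn => // /negP; rewrite inE => /h0 ->.
Qed.

(** Assumptions A1 and A2 for a single density, bundled because convex combinations preserve them.
    For [0 < eps], nonnegativity follows from the bounds. *)
Definition truncated_density d (T : measurableType d) (R : realType)
    (mu : {measure set T -> \bar R}) (A : set T) (eps M : R) (q : T -> R) :=
  [/\ measurable_fun setT q, forall z, ~ A z -> q z = 0,
      forall z, A z -> eps <= q z <= M & (\int[mu]_z (q z)%:E = 1)%E].

Lemma truncated_density_support d (T : measurableType d) (R : realType)
    (mu : {measure set T -> \bar R}) (A : set T) (eps M : R) (q : T -> R) :
  0 < eps -> truncated_density mu A eps M q -> measurable A /\ (mu A < +oo)%E.
Proof.
move=> e0 [mq q0 qb q1].
have mA : measurable A.
  rewrite (_ : A = q @^-1` `[eps, +oo[%classic); last first.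
    apply/seteqP; split=> z /=; rewrite in_itv/= andbT; first by move=> /qb/andP[].
    by move=> eq_; apply: contrapT => /q0 qz; move: eq_; rewrite qz leNgt e0.
  by rewrite -[X in measurable X]setTI; exact: mq.
split=> //; have : (eps%:E * mu A <= 1)%E.
  rewrite -q1 (integral_support mu q0) -integral_cst//; apply: ge0_le_integral => //.
  - by move=> z _; rewrite lee_fin ltW.
  - by apply/measurable_EFinP; exact: measurable_funTS.
  - by move=> z /qb/andP[]; rewrite lee_fin.
move=> h; rewrite ltNge leye_eq; apply/negP => /eqP muA.
by move: h; rewrite muA gt0_muley ?lte_fin// leye_eq.
Qed.

Lemma le_norm_integrable d (T : measurableType d) (R : realType)
    (mu : {measure set T -> \bar R}) (A : set T) (h : T -> R) (K : R) :
  measurable A -> (mu A < +oo)%E -> measurable_fun A h ->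
  (forall z, A z -> `|h z| <= K) -> mu.-integrable A (EFin \o h).
Proof.
move=> mA muA mh hK; apply: measurable_bounded_integrable => //.
exists K; split; first exact: num_real.
by move=> x Kx z Az; apply: le_trans (ltW Kx); exact: hK.
Qed.

(* Convexity of the square bounds the distance to [s] along segments. *)
Lemma truncated_density_conv d (T : measurableType d) (R : realType)
    (mu : {measure set T -> \bar R}) (A : set T) (eps M : R) (s p q : T -> R)
    (a : \bar R) (t : R) :
  0 < eps -> measurable_fun setT s -> 0 <= t <= 1 ->
  truncated_density mu A eps M p -> truncated_density mu A eps M q ->
  (L2_dist mu s p ^+ 2 <= a)%E -> (L2_dist mu s q ^+ 2 <= a)%E ->
  let r := fun z => t * p z + (1 - t) * q z in
  truncated_density mu A eps M r /\ (L2_dist mu s r ^+ 2 <= a)%E.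
Proof.
move=> e0 ms /andP[t0 t1] [mp p0 pb p1] [mq q0 qb q1].
rewrite !L2_distE => pa qa r.
have t1' : 0 <= 1 - t by rewrite subr_ge0.
have pp z : 0 <= p z.
  by have [/pb/andP[ep _]|/p0 ->//] := pselect (A z); apply: le_trans ep; exact: ltW.
have qq z : 0 <= q z.
  by have [/qb/andP[ep _]|/q0 ->//] := pselect (A z); apply: le_trans ep; exact: ltW.
have comb (u v : T -> R) : measurable_fun setT u -> measurable_fun setT v ->
    (forall z, 0 <= u z) -> (forall z, 0 <= v z) ->
    (\int[mu]_z (t * u z + (1 - t) * v z)%:E =
     t%:E * \int[mu]_z (u z)%:E + (1 - t)%:E * \int[mu]_z (v z)%:E)%E.
  move=> mu' mv u0 v0; rewrite -!ge0_integralZl_EFin//.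
  - rewrite -ge0_integralD//.
    + by move=> z _; rewrite lee_fin mulr_ge0.
    + by apply/measurable_EFinP; exact: measurable_funM.
    + by move=> z _; rewrite lee_fin mulr_ge0.
    + by apply/measurable_EFinP; exact: measurable_funM.
  - by move=> z _; rewrite lee_fin.
  - exact/measurable_EFinP.
  - by move=> z _; rewrite lee_fin.
  - exact/measurable_EFinP.
have msub (u : T -> R) : measurable_fun setT u ->
    measurable_fun setT (fun z => (s z - u z) ^+ 2).
  by move=> mu'; apply/measurable_funX/measurable_funB.
have mr : measurable_fun setT r.
  by apply: measurable_funD; apply: measurable_funM.
split; first split => //.
- by move=> z Az; rewrite /r p0// q0// !mulr0 addr0.
- by move=> z Az; have /andP[? ?] := pb z Az; have /andP[? ?] := qb z Az; rewrite /r; nra.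
- by rewrite /r comb// p1 q1 !mule1 -EFinD addrCA subrr addr0.
rewrite L2_distE; apply: (@le_trans _ _
    (t%:E * a + (1 - t)%:E * a)%E).
  apply: le_trans (leeD (lee_wpmul2l _ pa) (lee_wpmul2l _ qa)) => //.
  rewrite -comb//; [|exact: msub|exact: msub|by move=> z; exact: sqr_ge0..].
  apply: ge0_le_integral => //.
  - by move=> z _; rewrite lee_fin sqr_ge0.
  - by apply/measurable_EFinP/msub.
  - by apply/measurable_EFinP; apply: measurable_funD; apply: measurable_funM => //;
      exact: msub.
  - move=> z _; rewrite lee_fin -subr_ge0.
    (* The convexity defect of the square, which does not depend on [s]. *)
    rewrite /r (_ : _ - _ = t * (1 - t) * (p z - q z) ^+ 2); last by ring.
    by apply: mulr_ge0; [exact: mulr_ge0|exact: sqr_ge0].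
(* The nonnegative weights sum to 1; distributivity thus holds even for infinite [a]. *)
rewrite -ge0_muleDl ?lee_fin// -EFinD addrCA subrr addr0 mul1e//.
Qed.

(** The hull is the smallest convex set containing [Q], so it lies in the set [C] of truncated
    densities within [L2_diam mu Q] of [s], which is convex and contains [Q]. *)
Lemma conv_hull_truncated_density d (T : measurableType d) (R : realType)
    (mu : {measure set T -> \bar R}) (A : set T) (eps M : R) (Q : set (T -> R))
    (s q : T -> R) :
  0 < eps -> (forall p, Q p -> truncated_density mu A eps M p) ->
  Q s -> conv_hull Q q ->
  truncated_density mu A eps M q /\
  (L2_dist mu s q ^+ 2 <= L2_diam mu Q ^+ 2)%E.
Proof.
move=> e0 Qd Qs; pose C := [set p | truncated_density mu A eps M p /\
  (L2_dist mu s p ^+ 2 <= L2_diam mu Q ^+ 2)%E].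
apply: (@smallest_sub _ _ _ C).
  move=> p r t; rewrite !inE => -[dp ps] [dr rs].
  have [ms _ _ _] := Qd _ Qs.
  have t01 : 0 <= t%:num <= 1 by rewrite ge0 le1.
  exact: (truncated_density_conv e0 ms t01 dp dr ps rs).
move=> p Qp; split; first exact: Qd.
by rewrite lee_sqr ?Lnorm_ge0 ?L2_diam_ge0// L2_dist_le_diam.
Qed.

(** * Integrability of the divergence and a single curvature term *)

Lemma measurable_ln_div d (T : measurableType d) (R : realType) (A : set T)
    (q p : T -> R) : measurable_fun A q -> measurable_fun A p ->
  (forall z, A z -> 0 < q z) -> (forall z, A z -> 0 < p z) ->
  measurable_fun A (fun z => ln (q z / p z)).
Proof.
move=> mq mp q0 p0.
apply: (@eq_measurable_fun _ _ _ _ _ (fun z => ln (q z) - ln (p z))).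
  by move=> z; rewrite inE => Az; rewrite ln_div// posrE ?q0 ?p0.
by apply: measurable_funB; apply: measurableT_comp => //; exact: measurable_ln.
Qed.

(* The negative part of q ln (q / p) is at most p, so that its integral cannot
   be -oo, and it is +oo whenever the integrand is not integrable. *)
Lemma KL_div_integrable d (T : measurableType d) (R : realType)
    (mu : {measure set T -> \bar R}) (A : set T) (q p : T -> R) :
  measurable A -> measurable_fun A q -> measurable_fun A p ->
  (forall z, A z -> 0 < q z) -> (forall z, A z -> 0 < p z) ->
  (\int[mu]_(z in A) (p z)%:E < +oo)%E -> KL_div mu A q p != +oo%E ->
  mu.-integrable A (fun z => (q z * ln (q z / p z))%:E).
Proof.
move=> mA mq mp q0 p0 pfin; rewrite /KL_div; set g := fun z => _ => gfin.
have mg : measurable_fun A g.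
  by apply/measurable_EFinP; apply: measurable_funM => //; exact: measurable_ln_div.
have gneg : (\int[mu]_(z in A) g^\- z < +oo)%E.
  apply: le_lt_trans pfin; apply: ge0_le_integral => //.
  - exact: measurable_funeneg.
  - exact/measurable_EFinP.
  - move=> z Az; rewrite funenegE ge_max; apply/andP; split; last first.
      by rewrite lee_fin ltW ?p0.
    (* Since [q z > 0], the integrand is at least [q z - p z >= - p z]. *)
    have := sub_le_mul_ln (q0 z Az) (p0 z Az); have := q0 z Az.
    by rewrite /g -EFinN lee_fin; lra.
apply/integrableP; split => //.
under eq_integral do rewrite -/((abse \o g) _).
rewrite fune_abse ge0_integralD//; [|exact: measurable_funepos|exact: measurable_funeneg].
rewrite lte_add_pinfty// ltey; apply: contra gfin => /eqP gpos.
by rewrite integralE gpos addye// -[-oo%E]/(- +oo)%E eqe_opp lt_eqF.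
Qed.

(** Since [y - q] is [gamma] times [s - q], the quadratic remainder carries a factor
    [gamma ^+ 2 / (2 * eps)], which [2 / gamma ^+ 2] turns into [1 / eps]. *)
Lemma curvature_term_le d (T : measurableType d) (R : realType)
    (mu : {measure set T -> \bar R}) (A : set T) (eps M : R)
    (s q y p : T -> R) (gamma : R) :
  0 < eps -> truncated_density mu A eps M s -> truncated_density mu A eps M q ->
  measurable_fun A p -> (forall z, A z -> 0 < p z) ->
  (\int[mu]_(z in A) (p z)%:E < +oo)%E -> 0 < gamma <= 1 ->
  y = (fun z => q z + gamma * (s z - q z)) ->
  ((2 / gamma ^+ 2)%:E * (KL_div mu A y p - KL_div mu A q p -
     L2_inner mu (fun z => y z - q z)%R (KL_grad q p)) <=
   (1 / eps)%:E * L2_dist mu s q ^+ 2)%E.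
Proof.
move=> e0 sd qd mp p0 pfin g01 yE; have /andP[g0 g1] := g01.
have [mA muA] := truncated_density_support e0 qd.
have [ms s0 sb s1] := sd; have [mq q0 qb q1] := qd.
have [my y0 yb y1] : truncated_density mu A eps M y.
  have -> : y = (fun z => gamma * s z + (1 - gamma) * q z).
    by apply/funext => z; rewrite yE; ring.
  have g01' : 0 <= gamma <= 1 by rewrite ltW.
  (* Only the density half is wanted, so the distance bound is taken to be [+oo]. *)
  by have [] := truncated_density_conv e0 ms g01' sd qd (leey _) (leey _).
have [qy|qy] := eqVneq (KL_div mu A q p) +oo%E.
  (* [-oo] absorbs any summand, even [+oo], and the positive factor keeps it. *)
  rewrite qy addeNy addNye gt0_muleNy ?leNye// lte_fin divr_gt0//.
  exact: exprn_gt0.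
have qA z : A z -> 0 < q z by move=> /qb/andP[+ _]; exact: lt_le_trans.
have yA z : A z -> 0 < y z by move=> /yb/andP[+ _]; exact: lt_le_trans.
have mqA : measurable_fun A q by exact: measurable_funTS.
have myA : measurable_fun A y by exact: measurable_funTS.
have bounded_int (h : T -> R) (K : R) : measurable_fun A h ->
    (forall z, A z -> `|h z| <= K) -> mu.-integrable A (EFin \o h).
  exact: le_norm_integrable.
(* On [A], [ln (y / p) = u + v]: the part with [u] cancels against the other two terms, and [y * v]
   is the integrand that remains. *)
pose u z := ln (q z / p z); pose v z := ln (y z / q z).
have mu' : measurable_fun A u by exact: measurable_ln_div.
have mv : measurable_fun A v by exact: measurable_ln_div.
(* [u] may be unbounded, as [p] can approach 0, but [q >= eps] makes it dominated by
   [eps^-1 * (q * u)]. *)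
have ui : mu.-integrable A (EFin \o u).
  have gi := KL_div_integrable mA mqA mp qA p0 pfin qy.
  apply: le_integrable (integrableZl mA eps^-1 gi) => //; first exact/measurable_EFinP.
  move=> z Az; rewrite /= lee_fin mulrA normrM ler_peMl//.
  have /andP[eq_ _] := qb z Az.
  by rewrite (le_trans _ (ler_norm _))// ler_pdivlMl// mulr1.
have hui (h : T -> R) : measurable_fun A h -> (forall z, A z -> `|h z| <= M) ->
    mu.-integrable A (EFin \o (fun z => h z * u z)).
  move=> mh hM; apply: (integrableMr mA mh _ ui).
  exists M; split; first exact: num_real.
  by move=> x Mx z Az; apply: le_trans (ltW Mx); exact: hM.
have le_M (h : T -> R) : (forall z, A z -> eps <= h z <= M) ->
    forall z, A z -> `|h z| <= M.
  by move=> hb z /hb/andP[eh hM]; rewrite ger0_norm//; exact: le_trans (ltW e0) eh.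
have qui := hui _ mqA (le_M _ qb); have yui := hui _ myA (le_M _ yb).
(* [y * v] is bounded: it lies between [y - q >= - M] and [(y - q) + (y - q) ^+ 2 / (2 * eps)]. *)
have yvi : mu.-integrable A (EFin \o (fun z => y z * v z)).
  apply: (bounded_int _ (M + M ^+ 2 / (2 * eps))); first exact: measurable_funM.
  move=> z Az; have /andP[ey yM] := yb z Az; have /andP[eq_ qM] := qb z Az.
  have lo := sub_le_mul_ln (yA z Az) (qA z Az).
  have up := mul_ln_le_quad e0 ey eq_.
  have : (y z - q z) ^+ 2 / (2 * eps) <= M ^+ 2 / (2 * eps).
    by rewrite ler_wpM2r ?invr_ge0 ?mulr_ge0 ?(ltW e0)//; nra.
  have : 0 <= M ^+ 2 / (2 * eps) by rewrite divr_ge0 ?sqr_ge0// mulr_ge0// ltW.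
  by move=> ? ?; rewrite ler_norml; apply/andP; split; rewrite /v; lra.
have qi : mu.-integrable A (EFin \o q) by exact: bounded_int (le_M _ qb).
have yi : mu.-integrable A (EFin \o y) by exact: bounded_int (le_M _ yb).
have s_qi : mu.-integrable A (EFin \o (fun z => (s z - q z) ^+ 2)).
  apply: (bounded_int _ (M ^+ 2)).
    by apply: measurable_funX; apply: measurable_funB => //; exact: measurable_funTS.
  move=> z Az; have /andP[? ?] := sb z Az; have /andP[? ?] := qb z Az.
  by rewrite ger0_norm ?sqr_ge0//; nra.
have -> : (KL_div mu A y p = \int[mu]_(z in A) (y z * u z)%:E +
                             \int[mu]_(z in A) (y z * v z)%:E)%E.
  rewrite -integralD_EFin//; apply: eq_integral => z; rewrite inE => Az /=.
  rewrite -EFinD -mulrDr /u /v !ln_div ?posrE ?qA ?yA ?p0//.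
  by congr EFin; ring.
have -> : (KL_div mu A q p = \int[mu]_(z in A) (q z * u z)%:E)%E by [].
have -> : (L2_inner mu (fun z => y z - q z)%R (KL_grad q p) =
    \int[mu]_(z in A) (y z * u z)%:E - \int[mu]_(z in A) (q z * u z)%:E)%E.
  rewrite -integralB_EFin// /L2_inner (@integral_support _ _ _ mu A).
    by apply: eq_integral => z _; rewrite -EFinB -mulrBl.
  by move=> z Az; rewrite y0// q0// subrr mul0r.
(* Finiteness of the integrals is what makes this cancellation valid in the extended reals. *)
have addB3 (a b c : \bar R) : a \is a fin_num -> b \is a fin_num ->
    c \is a fin_num -> (a + b - c - (a - c) = b)%E.
  move: a b c => [a| |] [b| |] [c| |]// _ _ _.
  by rewrite -!(EFinD, EFinN); congr EFin; ring.
rewrite addB3; [|exact: integrable_fin_num yui|exact: integrable_fin_num yvi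
  |exact: integrable_fin_num qui].
have wE : (L2_dist mu s q ^+ 2 = \int[mu]_(z in A) ((s z - q z) ^+ 2)%:E)%E.
  rewrite L2_distE (@integral_support _ _ _ mu A)// => z Az.
  by rewrite s0// q0// subrr expr0n.
have wi := integrableZl mA (gamma ^+ 2 / (2 * eps)) s_qi.
have dyq := integrableB mA yi qi.
have : (\int[mu]_(z in A) (y z * v z)%:E <= \int[mu]_(z in A)
    ((y z)%:E - (q z)%:E + (gamma ^+ 2 / (2 * eps))%:E * ((s z - q z) ^+ 2)%:E))%E.
  apply: le_integral => //; first exact: integrableD dyq wi.
  move=> z; rewrite inE => Az; have /andP[ey _] := yb z Az; have /andP[eq_ _] := qb z Az.
  rewrite -!(EFinD, EFinN, EFinM) lee_fin; apply: le_trans (mul_ln_le_quad e0 ey eq_) _.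
  by rewrite le_eqVlt; apply/orP/or_introl/eqP; rewrite yE; field; rewrite gt_eqF.
rewrite (integralD mA dyq wi) (integralB mA yi qi).
(* Both [y] and [q] have mass 1, so the linear term vanishes. *)
rewrite -(integral_support mu y0) -(integral_support mu q0) y1 q1 subee// add0e.
rewrite (integralZl mA s_qi) -wE => h.
apply: le_trans (lee_wpmul2l _ h) _; first by rewrite lee_fin divr_ge0// sqr_ge0.
rewrite muleA -EFinM; apply: lee_wpmul2r; first by rewrite expe2 mule_ge0// Lnorm_ge0.
rewrite lee_fin le_eqVlt; apply/orP/or_introl/eqP.
by field; rewrite !gt_eqF.
Qed.

(** * Bound on the diameter and conclusion *)

(** On [A] two values in [[eps, M]] differ by at most [M], both being positive; off [A] both
    densities vanish. *)
Lemma L2_diam_truncated_density d (T : measurableType d) (R : realType)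
    (mu : {measure set T -> \bar R}) (A : set T) (eps M : R) (Q : set (T -> R)) :
  0 < eps -> (forall q, Q q -> truncated_density mu A eps M q) ->
  (L2_diam mu Q ^+ 2 <= (M ^+ 2)%:E * mu A)%E.
Proof.
move=> e0 Qd; apply: L2_diam_le; first by rewrite mule_ge0 ?lee_fin ?sqr_ge0.
move=> p q /Qd pd /Qd qd; have [mA _] := truncated_density_support e0 pd.
have [mp p0 pb _] := pd; have [mq q0 qb _] := qd.
rewrite L2_distE (@integral_support _ _ _ mu A); last first.
  by move=> z Az; rewrite p0// q0// subrr expr0n.
rewrite -integral_cst//; apply: ge0_le_integral => //.
- by move=> z _; rewrite lee_fin sqr_ge0.
- apply/measurable_EFinP; apply: measurable_funTS.
  by apply: measurable_funX; exact: measurable_funB.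
- move=> z Az; have /andP[? ?] := pb z Az; have /andP[? ?] := qb z Az.
  by rewrite lee_fin; nra.
Qed.

Theorem theorem6 (R : realType) (D : nat) (A : set (Rn R D)) (eps M : R)
    (Q : set (Rn R D -> R)) (Z : set (Rn R D)) (px : Rn R D -> R) (L : R) :
  compact A ->
  0 < eps -> eps <= M ->
  (forall q, Q q -> is_density (lebesgue_Rn R D) q) ->
  (forall q, Q q -> forall z, ~ A z -> q z = 0) ->
  (forall q, Q q -> forall z, A z -> eps <= q z <= M) ->
  is_density (lebesgue_Rn R D) px ->
  A `<=` Z ->
  (forall z, Z z -> 0 < px z) ->
  L = 1 / eps ->
  let mu := lebesgue_Rn R D in
  let f := (fun q => KL_div mu A q px) in
  let gradf := (fun q => KL_grad q px) in
  (curvature mu f gradf Q <= L%:E * L2_diam mu Q ^+ 2)%E /\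
  (L%:E * L2_diam mu Q ^+ 2 <= (4 * (M ^+ 2 / eps))%:E * mu A)%E.
Proof.
move=> _ e0 _ Qdens Q0 Qb [mpx px0 px1] AZ pxZ -> mu f gradf.
have Qd q : Q q -> truncated_density mu A eps M q.
  by move=> Qq; have [mq _ q1] := Qdens _ Qq; split => //; [exact: Q0|exact: Qb].
have L0 : 0 <= 1 / eps by rewrite divr_ge0// ltW.
split.
  apply: ge_ereal_sup => _ [s [q [y [gamma [Qs Qq g01 yE ->]]]]].
  have [qd sq] := conv_hull_truncated_density e0 Qd Qs Qq.
  apply: le_trans (lee_wpmul2l _ sq); last by rewrite lee_fin.
  have [mA _] := truncated_density_support e0 qd.
  apply: (curvature_term_le e0 (Qd _ Qs) qd) => //.
  - exact: measurable_funTS.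
  - by move=> z /AZ; exact: pxZ.
  (* The mass of [px] on [A] is at most its total mass 1. *)
  - apply: (@le_lt_trans _ _ (\int[mu]_z (px z)%:E)%E); last by rewrite px1 ltry.
    apply: ge0_subset_integral => //; first exact/measurable_EFinP.
    by move=> z _; rewrite lee_fin.
apply: le_trans (lee_wpmul2l _ (L2_diam_truncated_density e0 Qd)) _.
  by rewrite lee_fin.
rewrite muleA -EFinM; apply: lee_wpmul2r => //.
(* The diameter bound yields the constant [M ^+ 2 / eps], which is nonnegative, so the factor 4 only
   enlarges it. *)
rewrite lee_fin mul1r [_^-1 * _]mulrC ler_peMl//; last lra.
by rewrite divr_ge0 ?sqr_ge0// ltW.
Qed.
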